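(* The rational extension $\mathcal{Q}$, which sends each weakly multiplicative summation $(D,\mathfrak{S})$ to $(\mathcal{Q}D,\mathcal{Q}\mathfrak{S})$, is a well-defined functor $\mathcal{Q}:\mathbf{wMSum}\to\mathbf{MSum}$ and is an idempotent extension map which subsumes $\mathcal{M}$, $\mathcal{T}$, $\mathcal{M}\mathcal{T}$, and $\mathcal{T}\mathcal{M}$.
   Context: Let $R$ be a commutative unital ring with $0\neq 1$ and $E$ a commutative unital $R$-algebra with $0\neq 1$. A *summation on $R$ to $E$* is a tuple $(R,E,D,\mathfrak{S})$, abbreviated $(D,\mathfrak{S})$ or $\mathfrak{S}$, where $D$ is a set and $\mathfrak{S}:D\to E$ a map such that: (I) $R[\sigma]\subseteq D\subseteq R[[\sigma]]$; (II) $D$ is an $R$-module and $\mathfrak{S}$ is an $R$-module homomorphism; (III) $\mathfrak{S}(1)=1$; (IV) $(1-\sigma)D\subseteq D$ and $\mathfrak{S}$ factors through $D/(1-\sigma)D$ (i.e. $\mathfrak{S}((1-\sigma)X)=0$ for all $X\in D$). For summations $(D,\mathfrak{S})$, $(D',\mathfrak{S}')$ on the same $R$ to the same $E$, $\mathfrak{S}'$ *extends* $\mathfrak{S}$, written $\mathfrak{S}\subseteq\mathfrak{S}'$, if $D\subseteq D'$ and $\mathfrak{S}'|_D=\mathfrak{S}$. $\mathbf{Sum}$ is the posetal category whose objects are all summations and whose morphisms are extensions. A summation $(D,\mathfrak{S})$ is *multiplicative* if $D$ is an $R$-algebra (a subring of $R[[\sigma]]$) and $\mathfrak{S}$ is an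 $R$-algebra homomorphism; it is *weakly multiplicative* if it has an extension which is multiplicative. $\mathbf{MSum}\subseteq\mathbf{wMSum}$ are the full subcategories of $\mathbf{Sum}$ on the multiplicative and weakly multiplicative summations. For functors $\mathcal{F},\mathcal{G}$ on $\mathbf{wMSum}$ (with values in $\mathbf{wMSum}$): $\mathcal{F}$ is an *extension map* if $\mathcal{F}\mathfrak{S}\supseteq\mathfrak{S}$ for every $\mathfrak{S}$; $\mathcal{F}$ *subsumes* $\mathcal{G}$ if $\mathcal{F}=\mathcal{F}\circ\mathcal{G}=\mathcal{G}\circ\mathcal{F}$; $\mathcal{F}$ is *idempotent* if $\mathcal{F}\circ\mathcal{F}=\mathcal{F}$. $\mathrm{Reg}(E)$ is the set of non-zerodivisors of $E$. *Telescopic extension* $(\mathcal{T}D,\mathcal{T}\mathfrak{S})$ of a summation $(D,\mathfrak{S})$: $X\in R[[\sigma]]$ belongs to $\mathcal{T}D$ iff there exist $A\in D$, $F\in R[\sigma]$, $f\in\mathrm{Reg}(E)$, $x\in E$ with $A=FX$, $\mathfrak{S}(F)=f$, $\mathfrak{S}(A)=fx$; then $\mathcal{T}\mathfrak{S}(X):=x$. *Multiplicative extension* $(\mathcal{M}D,\mathcal{M}\mathfrak{S})$ of a weakly multiplicative summation $(D,\mathfrak{S})$: $X\in R[[\sigma]]$ belongs to $\mathcal{M}D$ iff $X=\sum_{i=1}^{\ell}\prod_{j=1}^{k_i}X_{i,j}$ for some $\ell,k_i\in\mathbb{N}=\{0,1,2,\dots\}$ and $X_{i,j}\in D$; then $\mathcal{M}\mathfrak{S}(X):=\sum_{i=1}^{\ell}\prod_{j=1}^{k_i}\mathfrak{S}(X_{i,j})$.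 (Both are well defined; $\mathcal{T}$ maps $\mathbf{wMSum}$ to $\mathbf{wMSum}$ and $\mathbf{MSum}$ to $\mathbf{MSum}$; $\mathcal{M}$ maps $\mathbf{wMSum}$ to $\mathbf{MSum}$ and fixes multiplicative summations.) *Rational extension* $(\mathcal{Q}D,\mathcal{Q}\mathfrak{S})$ of a multiplicative summation $(D,\mathfrak{S})$: $X\in R[[\sigma]]$ belongs to $\mathcal{Q}D$ iff there exist $A,B\in D$, $b\in\mathrm{Reg}(E)$, $x\in E$ with $A=BX$, $\mathfrak{S}(B)=b$, $\mathfrak{S}(A)=bx$; then $\mathcal{Q}\mathfrak{S}(X):=x$. For a weakly multiplicative summation $(D,\mathfrak{S})$, set $(\mathcal{Q}D,\mathcal{Q}\mathfrak{S}):=(\mathcal{Q}\mathcal{M}D,\mathcal{Q}\mathcal{M}\mathfrak{S})$. *)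

(* Defs.v *)
From HB Require Import structures.
From mathcomp Require Import all_boot all_order all_algebra.
From mathcomp Require Import boolp classical_sets.

Set Implicit Arguments.
Unset Strict Implicit.
Unset Printing Implicit Defensive.

Import GRing.Theory.
Local Open Scope classical_set_scope.
Local Open Scope ring_scope.

(* A record rather than an alias of nat -> R, so that multiplication is never
   confused with the pointwise one on functions. *)
Record fps (R : Type) := FPS { fcoef : nat -> R }.

Lemma fpsP (R : Type) (X Y : fps R) :
  (forall n, fcoef X n = fcoef Y n) -> X = Y.
Proof. by case: X Y => f [g] /= fg; congr FPS; apply/funext. Qed.

HB.instance Definition _ (R : Type) := gen_eqMixin (fps R).
HB.instance Definition _ (R : Type) := gen_choiceMixin (fps R).

Section FpsAlgebra.
Variable R : comNzRingType.
Implicit Types (X Y Z : fps R) (a b : R).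

Definition fps_zero : fps R := FPS (fun=> 0).
Definition fps_opp X : fps R := FPS (fun n => - fcoef X n).
Definition fps_add X Y : fps R := FPS (fun n => fcoef X n + fcoef Y n).
Definition fps_one : fps R := FPS (fun n => (n == 0%N)%:R).
Definition fps_mul X Y : fps R :=
  FPS (fun n => \sum_(i < n.+1) fcoef X i * fcoef Y (n - i)%N).
Definition fps_scale a X : fps R := FPS (fun n => a * fcoef X n).

Let addA : associative fps_add.
Proof. by move=> X Y Z; apply: fpsP => n; exact: addrA. Qed.
Let addC : commutative fps_add.
Proof. by move=> X Y; apply: fpsP => n; exact: addrC. Qed.
Let add0 : left_id fps_zero fps_add.
Proof. by move=> X; apply: fpsP => n; exact: add0r. Qed.
Let addN : left_inverse fps_zero fps_opp fps_add.
Proof. by move=> X; apply: fpsP => n; exact: addNr. Qed.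

HB.instance Definition _ := GRing.isZmodule.Build (fps R) addA addC add0 addN.

(* The ring axioms are transported from {poly R} through truncations. *)
Let trunc N X : {poly R} := \poly_(i < N) fcoef X i.

Let coef_trunc N X n : (n < N)%N -> (trunc N X)`_n = fcoef X n.
Proof. by move=> nN; rewrite coef_poly nN. Qed.

Let fcoef_mul X Y (p q : {poly R}) n :
    (forall i, (i <= n)%N -> p`_i = fcoef X i) ->
    (forall i, (i <= n)%N -> q`_i = fcoef Y i) ->
  (p * q)`_n = fcoef (fps_mul X Y) n.
Proof.
move=> pX qY; rewrite coefM /=; apply: eq_bigr => i _.
by rewrite pX ?qY ?leq_subr // -ltnS.
Qed.

Let mulA : associative fps_mul.
Proof.
move=> X Y Z; apply: fpsP => n; pose t := trunc n.+1.
have tE U i : (i <= n)%N -> (t U)`_i = fcoef U i by move=> ?; exact: coef_trunc.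
have tME U V i : (i <= n)%N -> (t U * t V)`_i = fcoef (fps_mul U V) i.
  by move=> lein; apply: fcoef_mul => j ji; exact: tE (leq_trans ji lein).
rewrite -(@fcoef_mul X (fps_mul Y Z) (t X) (t Y * t Z)) //; last exact: tME.
  rewrite mulrA; apply: fcoef_mul; [exact: tME | exact: tE].
exact: tE.
Qed.

Let mulC : commutative fps_mul.
Proof.
move=> X Y; apply: fpsP => n; pose t := trunc n.+1.
have tE U i : (i <= n)%N -> (t U)`_i = fcoef U i by move=> ?; exact: coef_trunc.
rewrite -(@fcoef_mul X Y (t X) (t Y)); try exact: tE.
by rewrite mulrC; apply: fcoef_mul; exact: tE.
Qed.

Let mul1 : left_id fps_one fps_mul.
Proof.
move=> X; apply: fpsP => n /=; rewrite big_ord_recl /= mul1r subn0.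
by rewrite big1 ?addr0 // => i _; rewrite mul0r.
Qed.

Let mulDl : left_distributive fps_mul fps_add.
Proof.
move=> X Y Z; apply: fpsP => n /=; rewrite -big_split /=.
by apply: eq_bigr => i _; rewrite mulrDl.
Qed.

Let one_neq0 : fps_one != fps_zero.
Proof. by apply/eqP => -[/(congr1 (fun f => f 0%N))] /eqP; rewrite oner_eq0. Qed.

HB.instance Definition _ :=
  GRing.Zmodule_isComNzRing.Build (fps R) mulA mulC mul1 mulDl one_neq0.

Let scaleA a b X : fps_scale a (fps_scale b X) = fps_scale (a * b) X.
Proof. by apply: fpsP => n; exact: mulrA. Qed.
Let scale1 : left_id 1 fps_scale.
Proof. by move=> X; apply: fpsP => n; exact: mul1r. Qed.
Let scaleDr : right_distributive fps_scale +%R.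
Proof. by move=> a X Y; apply: fpsP => n; exact: mulrDr. Qed.
Let scaleDl X : {morph fps_scale^~ X : a b / a + b}.
Proof. by move=> a b; apply: fpsP => n; exact: mulrDl. Qed.

HB.instance Definition _ :=
  GRing.Zmodule_isLmodule.Build R (fps R) scaleA scale1 scaleDr scaleDl.

Let scaleAl a X Y : a *: (X * Y) = (a *: X) * Y.
Proof.
apply: fpsP => n /=; rewrite mulr_sumr.
by apply: eq_bigr => i _; rewrite mulrA.
Qed.

HB.instance Definition _ := GRing.Lmodule_isLalgebra.Build R (fps R) scaleAl.
HB.instance Definition _ := GRing.Lalgebra_isComAlgebra.Build R (fps R).

Definition fps_of_poly (p : {poly R}) : fps R := FPS (fun i => p`_i).

Definition sigma : fps R := fps_of_poly 'X.

End FpsAlgebra.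

Arguments sigma {R}.

Definition Reg (E : comNzRingType) : set E :=
  [set e | forall y, e * y = 0 -> y = 0].

(* A pair (D, S) of a set D of power series and a map S : D -> E, encoded as a
   total map which vanishes outside D; thus Leibniz equality of presummations
   is equality of the pairs (D, S). *)
Record presummation (R : comNzRingType) (E : comAlgType R) := Presummation {
  sdom : set (fps R);
  sfun :> fps R -> E;
  sfun_out : forall X, ~ sdom X -> sfun X = 0
}.

Section Summations.
Variables (R : comNzRingType) (E : comAlgType R).
Implicit Types (S : presummation E) (X Y : fps R) (x : E).
Implicit Types (F G : presummation E -> presummation E).
Implicit Types (C : set (presummation E)).

Record is_summation S : Prop := IsSummation {
  summation_poly : forall p : {poly R}, sdom S (fps_of_poly p);
  summation_submod : submod_closed [in sdom S];
  summation_linear : forall (a : R) X Y, sdom S X -> sdom S Y ->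
    S (a *: X + Y) = a *: S X + S Y;
  summation1 : S 1 = 1;
  summation_shift_dom : forall X, sdom S X -> sdom S ((1 - sigma) * X);
  summation_shift : forall X, sdom S X -> S ((1 - sigma) * X) = 0
}.

Definition extends S S' : Prop :=
  sdom S `<=` sdom S' /\ forall X, sdom S X -> S' X = S X.

Record is_multiplicative S : Prop := IsMultiplicative {
  multiplicative_summation : is_summation S;
  multiplicative_subalg : subalg_closed [in sdom S];
  multiplicativeM : forall X Y, sdom S X -> sdom S Y -> S (X * Y) = S X * S Y
}.

Definition MSum : set (presummation E) := [set S | is_multiplicative S].

Definition wMSum : set (presummation E) :=
  [set S | is_summation S /\ exists S', MSum S' /\ extends S S'].

(* Between posetal categories a functor is a monotone map on objects. *)
Definition is_functor C C' F : Prop :=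
  (forall S, C S -> C' (F S)) /\
  (forall S S', C S -> C S' -> extends S S' -> extends (F S) (F S')).

Definition is_extension_map F : Prop := forall S, wMSum S -> extends S (F S).

Definition subsumes F G : Prop :=
  forall S, wMSum S -> F S = F (G S) /\ F S = G (F S).

Definition is_idempotent F : Prop := forall S, wMSum S -> F (F S) = F S.

Definition functional_graph (g : fps R -> E -> Prop) : Prop :=
  forall X x y, g X x -> g X y -> x = y.

Lemma graph_out (g : fps R -> E -> Prop) X :
  ~ [set X | exists x, g X x] X -> xget 0 [set x | g X x] = 0.
Proof. by move=> nX; apply: xgetPN => x gx; apply: nX; exists x. Qed.

(* The domain is the set of X related to some x; the value at X is a chosen
   such x, hence is *the* such x when g is functional. *)
Definition of_graph (g : fps R -> E -> Prop) : presummation E :=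
  Presummation (@graph_out g).

Definition telescopic_graph S X x : Prop :=
  exists (A : fps R) (F : {poly R}) (f : E),
    [/\ sdom S A, Reg f, A = fps_of_poly F * X,
        S (fps_of_poly F) = f & S A = f * x].

Definition telescopic S := of_graph (telescopic_graph S).

Definition multiplicative_graph S X x : Prop :=
  exists (l : nat) (k : nat -> nat) (Y : nat -> nat -> fps R),
    [/\ forall i j, (i < l)%N -> (j < k i)%N -> sdom S (Y i j),
        X = \sum_(i < l) \prod_(j < k i) Y i j
      & x = \sum_(i < l) \prod_(j < k i) S (Y i j)].

Definition multiplicative_ext S := of_graph (multiplicative_graph S).

Definition rational_graph S X x : Prop :=
  exists (A B : fps R) (b : E),
    [/\ sdom S A /\ sdom S B, Reg b, A = B * X, S B = b & S A = b * x].

Definition rational_mult S := of_graph (rational_graph S).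

(* On multiplicative summations this should agree with rational_mult, since
   multiplicative_ext fixes them. *)
Definition rational S := rational_mult (multiplicative_ext S).

End Summations.

(* Main.v *)
Require Import Defs.
From HB Require Import structures.
From mathcomp Require Import all_boot all_order all_algebra.
From mathcomp Require Import boolp classical_sets.

(* The graph of each extension is monotone in the summation, and is functional
   as soon as the summation embeds in a multiplicative one; M fixes
   multiplicative summations, and Q is idempotent on them since denominators can
   be multiplied together.  Hence every S' with S <= S' <= Q S satisfies
   Q S <= Q S' <= Q Q S = Q S.  The four extensions M, T, MT, TM of S all lie
   between S and Q S, because M and T fix Q S, a polynomial denominator being a
   special case of a denominator in the domain. *)

Set Implicit Arguments.
Unset Strict Implicit.
Unset Printing Implicit Defensive.

Import GRing.Theory.
Local Open Scope classical_set_scope.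
Local Open Scope ring_scope.

Section RationalExtension.
Variables (R : comNzRingType) (E : comAlgType R).
Implicit Types (S T U : presummation E) (X Y : fps R) (x y : E).
Implicit Types (g h : fps R -> E -> Prop).

(** * Regular elements of the target algebra *)

Lemma Reg1 : Reg (1 : E).
Proof. by move=> y; rewrite mul1r. Qed.

Lemma RegM (b c : E) : Reg b -> Reg c -> Reg (b * c).
Proof. by move=> rb rc y; rewrite -mulrA => /rb/rc. Qed.

Lemma Reg_mulI (b : E) : Reg b -> injective ( *%R b).
Proof.
move=> rb x y bxy; apply/eqP; rewrite -subr_eq0; apply/eqP/rb.
by rewrite mulrBr bxy subrr.
Qed.

(** * Extension as a partial order on presummations *)

Lemma extends_refl S : extends S S.
Proof. by split. Qed.

Lemma extends_trans T S U : extends S T -> extends T U -> extends S U.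
Proof.
move=> [ST eST] [TU eTU]; split=> X SX; first exact/TU/ST.
by rewrite eTU ?eST //; exact: ST.
Qed.

(** The domains coincide and the maps agree on them; outside, both maps vanish by [sfun_out], so
    they agree as total functions. *)
Lemma extends_anti S T : extends S T -> extends T S -> S = T.
Proof.
move=> [ST eST] [TS _]; have dE : sdom S = sdom T by apply/seteqP.
have fE : sfun S = sfun T.
  apply/funext => X; have [SX|nSX] := pselect (sdom S X); first by rewrite eST.
  by rewrite !sfun_out // -dE.
case: S T dE fE {ST eST TS} => [D f fo] [D' f' fo'] /= dE fE.
(* The vanishing proof depends on both other fields, so these are identified first; two proofs of
   one proposition remain. *)
case: _ / dE fo' => fo'; case: _ / fE fo' => fo'.
by congr Presummation; exact: Prop_irrelevance.
Qed.

(** * Presummations defined by graphs *)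

Lemma of_graph_in g X : sdom (of_graph g) X -> g X (of_graph g X).
Proof. by move=> gX; exact: (@xgetPex E 0 [set x | g X x]). Qed.

Lemma of_graph_val g X x : functional_graph g -> g X x -> of_graph g X = x.
Proof. by move=> gf gx; apply: (gf _ _ _ (of_graph_in _) gx); exists x. Qed.

Lemma extends_of_graph S h : functional_graph h ->
  (forall X, sdom S X -> h X (S X)) -> extends S (of_graph h).
Proof.
by move=> hf Sh; split=> X /Sh hX; [exists (S X) | exact: of_graph_val].
Qed.

Lemma of_graph_extends g h : (forall X x, g X x -> h X x) ->
  functional_graph h -> extends (of_graph g) (of_graph h).
Proof.
by move=> gh hf; apply: extends_of_graph => // X /of_graph_in; exact: gh.
Qed.

Lemma functional_graphS g h : (forall X x, g X x -> h X x) ->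
  functional_graph h -> functional_graph g.
Proof. by move=> gh hf X x y /gh hx /gh hy; exact: hf hx hy. Qed.

(** * Elementary consequences of the summation axioms *)

Lemma summation_dom1 S : is_summation S -> sdom S 1.
Proof.
move=> /summation_poly/(_ 1); congr (sdom S _).
by apply: fpsP => n /=; rewrite coef1.
Qed.

Lemma summation_dom0 S : is_summation S -> sdom S 0.
Proof. by move=> /summation_submod[/set_mem]. Qed.

Lemma summation_domZD S a X Y : is_summation S ->
  sdom S X -> sdom S Y -> sdom S (a *: X + Y).
Proof.
move=> /summation_submod[_ SZD] /mem_set SX /mem_set SY.
exact/set_mem/SZD.
Qed.

Lemma summation0 S : is_summation S -> S 0 = 0.
Proof.
move=> sS; have S1 := summation_dom1 sS.
(* Linearity is stated only for [a *: X + Y], so [0] is written as [-1 *: 1 + 1]. *)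
by rewrite -(addNr 1) -scaleN1r (summation_linear sS) // scaleN1r addNr.
Qed.

Lemma summation_algebra S (a : R) : is_summation S ->
  sdom S a%:A /\ S a%:A = a%:A.
Proof.
move=> sS; have S1 := summation_dom1 sS; have S0 := summation_dom0 sS.
rewrite -[X in sdom S X]addr0 -[X in S X]addr0; split.
  exact: summation_domZD.
by rewrite (summation_linear sS) // (summation1 sS) (summation0 sS) addr0.
Qed.

Lemma MSum_domM S X Y : MSum S -> sdom S X -> sdom S Y -> sdom S (X * Y).
Proof.
move=> /multiplicative_subalg[_ _ SM] /mem_set SX /mem_set SY.
exact/set_mem/SM.
Qed.

Lemma MSumD S X Y : MSum S -> sdom S X -> sdom S Y ->
  sdom S (X + Y) /\ S (X + Y) = S X + S Y.
Proof.
move=> [sS _ _] SX SY; rewrite -[X in X + Y]scale1r; split.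
  exact: summation_domZD.
by rewrite (summation_linear sS) // scale1r.
Qed.

(* The summation axioms pass from [S] to an algebra morphism extending it:
   the shift axiom reduces to [S (1 - sigma) = 0]. *)
Lemma MSum_extension S T : is_summation S -> extends S T ->
  (forall X Y, sdom T X -> sdom T Y ->
     sdom T (X + Y) /\ T (X + Y) = T X + T Y) ->
  (forall X Y, sdom T X -> sdom T Y ->
     sdom T (X * Y) /\ T (X * Y) = T X * T Y) -> MSum T.
Proof.
move=> sS [ST eST] TD TM.
have TA (a : R) : sdom T a%:A /\ T a%:A = a%:A.
  by have [Sa <-] := summation_algebra a sS; split; [exact: ST | exact: eST].
have TZD a X Y : sdom T X -> sdom T Y ->
    sdom T (a *: X + Y) /\ T (a *: X + Y) = a *: T X + T Y.
  move=> TX TY; have [Ta Ea] := TA a; have [TaX EaX] := TM _ _ Ta TX.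
  by have := TD _ _ TaX TY; rewrite EaX Ea !mulr_algl.
have T0 : sdom T 0 by exact/ST/summation_dom0.
have S1 := summation_dom1 sS.
have Ss : sdom S (1 - sigma).
  by rewrite -[X in sdom S X]mulr1; exact: summation_shift_dom.
have Es : T (1 - sigma) = 0.
  by rewrite eST // -[X in S X]mulr1 summation_shift.
have T1 := ST _ S1.
split.
- split.
  + by move=> p; exact/ST/summation_poly.
  + split=> [|a X Y /set_mem TX /set_mem TY]; apply: mem_set => //.
    by have [] := TZD a X Y TX TY.
  + by move=> a X Y TX TY; have [] := TZD a X Y TX TY.
  + by rewrite eST // summation1.
  + by move=> X TX; have [] := TM _ _ (ST _ Ss) TX.
  + by move=> X TX; have [_ ->] := TM _ _ (ST _ Ss) TX; rewrite Es mul0r.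
- split=> [|a X Y /set_mem TX /set_mem TY|X Y /set_mem TX /set_mem TY];
    apply: mem_set => //.
    by have [] := TZD a X Y TX TY.
  by have [] := TM X Y TX TY.
- by move=> X Y TX TY; have [] := TM X Y TX TY.
Qed.

Lemma MSum_wMSum S : MSum S -> wMSum S.
Proof. by move=> mS; split; [case: mS | exists S; split=> //; exact: extends_refl]. Qed.

(** * The multiplicative extension *)

Lemma multiplicative_graph_mono S T : extends S T ->
  forall X x, multiplicative_graph S X x -> multiplicative_graph T X x.
Proof.
move=> [ST eST] X x [l [k [Y [SY -> ->]]]]; exists l, k, Y; split=> //.
  by move=> i j il jk; exact/ST/SY.
by apply: eq_bigr => i _; apply: eq_bigr => j _; rewrite eST //; exact: SY.
Qed.

(** Membership and value form a single invariant, carried through the outer sum and then the inner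
    product: additivity and multiplicativity of [S] are available only on its domain. *)
Lemma multiplicative_graph_MSum S X x : MSum S ->
  multiplicative_graph S X x -> sdom S X /\ S X = x.
Proof.
move=> mS [l [k [Y [SY -> ->]]]]; have sS := multiplicative_summation mS.
apply: (big_rec2 (fun X x => sdom S X /\ S X = x)).
  by split; [exact: summation_dom0 | exact: summation0].
move=> i y Z _ [SZ <-].
suff [SP <-] : sdom S (\prod_(j < k i) Y i j) /\
    S (\prod_(j < k i) Y i j) = \prod_(j < k i) S (Y i j) by exact: MSumD.
apply: (big_rec2 (fun X x => sdom S X /\ S X = x)).
  by split; [exact: summation_dom1 | exact: summation1].
move=> j {}y {SZ}Z _ [SZ <-]; have SYij := SY i j (ltn_ord i) (ltn_ord j).
by split; [exact: MSum_domM | exact: multiplicativeM].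
Qed.

(** Every representation of [X] over [S] is one over [T], where it must evaluate to [T X]. *)
Lemma multiplicative_graph_functional S T : MSum T -> extends S T ->
  functional_graph (multiplicative_graph S).
Proof.
move=> mT ST; apply: functional_graphS (multiplicative_graph_mono ST) _.
move=> X x y /(multiplicative_graph_MSum mT)[_ <-].
by move=> /(multiplicative_graph_MSum mT)[_ <-].
Qed.

(* Lists of lists turn sums and products of sums of products into
   concatenations and [allpairs]. *)
Lemma multiplicative_graphP S X x : multiplicative_graph S X x <->
  exists L : seq (seq (fps R)),
    [/\ forall s Y, s \in L -> Y \in s -> sdom S Y,
        X = \sum_(s <- L) \prod_(Y <- s) Y
      & x = \sum_(s <- L) \prod_(Y <- s) S Y].
Proof.
split=> [[l [k [Y [SY -> ->]]]]|[L [SL -> ->]]].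
  exists [seq [seq Y i j | j <- iota 0 (k i)] | i <- iota 0 l]; split.
  - move=> s Z /mapP[i]; rewrite mem_iota add0n => il -> /mapP[j].
    by rewrite mem_iota add0n => jk ->; exact: SY.
  - rewrite big_map -(big_mkord predT (fun i => \prod_(j < k i) Y i j)).
    rewrite /index_iota subn0; apply: eq_bigr => i _.
    by rewrite big_map -(big_mkord predT (Y i)) /index_iota subn0.
  - rewrite big_map -(big_mkord predT (fun i => \prod_(j < k i) S (Y i j))).
    rewrite /index_iota subn0; apply: eq_bigr => i _.
    by rewrite big_map -(big_mkord predT (fun j => S (Y i j))) /index_iota subn0.
(* The defaults [[::]] and [0] are harmless: only indices within the lists enter the sums and
   products. *)
exists (size L), (fun i => size (nth [::] L i)), (fun i => nth 0 (nth [::] L i)).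
split.
- move=> i j il jk; apply: (SL (nth [::] L i)); exact: mem_nth.
- rewrite (big_nth [::]) big_mkord; apply: eq_bigr => i _.
  by rewrite (big_nth 0) big_mkord.
- rewrite (big_nth [::]) big_mkord; apply: eq_bigr => i _.
  by rewrite (big_nth 0) big_mkord.
Qed.

Lemma multiplicative_graph_dom S X : sdom S X -> multiplicative_graph S X (S X).
Proof.
move=> SX; apply/multiplicative_graphP; exists [:: [:: X]].
split; last 2 first; try by rewrite !big_seq1.
by move=> s Y; rewrite inE => /eqP ->; rewrite inE => /eqP ->.
Qed.

Lemma multiplicative_graphD S X Y x y :
  multiplicative_graph S X x -> multiplicative_graph S Y y ->
  multiplicative_graph S (X + Y) (x + y).
Proof.
move=> /multiplicative_graphP[L [SL -> ->]] /multiplicative_graphP[K [SK -> ->]].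
apply/multiplicative_graphP; exists (L ++ K).
split; last 2 first; try by rewrite big_cat.
by move=> s Z; rewrite mem_cat => /orP[/SL|/SK]; apply.
Qed.

(** Distributivity, with [f] general so that it serves both the series ([f] the identity) and their
    values ([f] equal to [S]). *)
Lemma sum_prod_allpairs (A : comNzRingType) (f : fps R -> A) L K :
  \sum_(s <- [seq s ++ t | s <- L, t <- K]) \prod_(Y <- s) f Y =
  (\sum_(s <- L) \prod_(Y <- s) f Y) * (\sum_(s <- K) \prod_(Y <- s) f Y).
Proof.
rewrite big_allpairs_dep mulr_suml; apply: eq_bigr => s _.
by rewrite mulr_sumr; apply: eq_bigr => t _; rewrite big_cat.
Qed.

Lemma multiplicative_graphM S X Y x y :
  multiplicative_graph S X x -> multiplicative_graph S Y y ->
  multiplicative_graph S (X * Y) (x * y).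
Proof.
move=> /multiplicative_graphP[L [SL -> ->]] /multiplicative_graphP[K [SK -> ->]].
apply/multiplicative_graphP; exists [seq s ++ t | s <- L, t <- K].
split; last 2 first; try by rewrite sum_prod_allpairs.
move=> s Z /allpairsP[[t u] /= [tL uK ->]].
by rewrite mem_cat => /orP[]; [exact: SL | exact: SK].
Qed.

Lemma multiplicative_ext_mono S T U : MSum U -> extends S T -> extends T U ->
  extends (multiplicative_ext S) (multiplicative_ext T).
Proof.
move=> mU ST TU; apply: of_graph_extends (multiplicative_graph_mono ST) _.
exact: multiplicative_graph_functional mU TU.
Qed.

Lemma extends_multiplicative_ext S T : MSum T -> extends S T ->
  extends S (multiplicative_ext S).
Proof.
move=> mT ST; apply: extends_of_graph (@multiplicative_graph_dom S).
exact: multiplicative_graph_functional mT ST.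
Qed.

Lemma multiplicative_ext_id S : MSum S -> multiplicative_ext S = S.
Proof.
move=> mS; apply: extends_anti (extends_multiplicative_ext mS (extends_refl S)).
by split=> X /of_graph_in/(multiplicative_graph_MSum mS)[].
Qed.

(** The graph is closed under sums and products, and functionality turns this closure into the
    additivity and multiplicativity that [MSum_extension] asks for. *)
Lemma multiplicative_ext_MSum S : wMSum S -> MSum (multiplicative_ext S).
Proof.
move=> wS; have [sS [T [mT ST]]] := wS.
have gf := multiplicative_graph_functional mT ST.
apply: MSum_extension sS (extends_multiplicative_ext mT ST) _ _ => X Y.
  move=> /of_graph_in gX /of_graph_in gY; have gXY := multiplicative_graphD gX gY.
  split; last exact: of_graph_val.
  by exists (multiplicative_ext S X + multiplicative_ext S Y).
move=> /of_graph_in gX /of_graph_in gY; have gXY := multiplicative_graphM gX gY.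
split; last exact: of_graph_val.
by exists (multiplicative_ext S X * multiplicative_ext S Y).
Qed.

(** * The rational extension of a multiplicative summation *)

Lemma rational_graph_mono S T : extends S T ->
  forall X x, rational_graph S X x -> rational_graph T X x.
Proof.
move=> [ST eST] X x [A [B [b [[SA SB] rb AE BE Ax]]]].
by exists A, B, b; split=> //; rewrite ?eST //; split; exact: ST.
Qed.

(** Cross-multiplication: [B' * A = B * A'] since both equal [B * B' * X]. Applying [S] gives
    [b' * b * x = b' * b * y], and the regular factor [b' * b] cancels. *)
Lemma rational_graph_functional S : MSum S -> functional_graph (rational_graph S).
Proof.
move=> mS X x y [A [B [b [[SA SB] rb AE BE Ax]]]]
  [A' [B' [b' [[SA' SB'] rb' AE' BE' Ay]]]].
apply: (Reg_mulI (RegM rb' rb)).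
have := congr1 S (_ : B' * A = B * A'); rewrite !(multiplicativeM mS) //.
rewrite BE' BE Ax Ay (mulrCA b b' y) !mulrA; apply.
by rewrite AE AE' mulrCA.
Qed.

Lemma rational_graph_dom S X : is_summation S -> sdom S X ->
  rational_graph S X (S X).
Proof.
move=> sS SX; exists X, 1, 1; split; rewrite ?mul1r //.
- by split=> //; exact: summation_dom1.
- exact: Reg1.
- exact: summation1.
Qed.

Lemma extends_rational_mult S : MSum S -> extends S (rational_mult S).
Proof.
move=> mS; apply: extends_of_graph => [|X]; first exact: rational_graph_functional.
exact/rational_graph_dom/multiplicative_summation.
Qed.

Lemma rational_graphD S X Y x y : MSum S ->
  rational_graph S X x -> rational_graph S Y y ->
  rational_graph S (X + Y) (x + y).
Proof.
move=> mS [A [B [b [[SA SB] rb AE BE Ax]]]]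
  [A' [B' [b' [[SA' SB'] rb' AE' BE' Ay]]]].
have SBA := MSum_domM mS SB' SA; have SBA' := MSum_domM mS SB SA'.
have [SD ED] := MSumD mS SBA SBA'.
(* Addition of fractions over the common denominator [B' * B]. *)
exists (B' * A + B * A'), (B' * B), (b' * b); split.
- by split=> //; exact: MSum_domM.
- exact: RegM.
- by rewrite AE AE' mulrDr -!mulrA (mulrCA B).
- by rewrite (multiplicativeM mS) // BE BE'.
- rewrite ED !(multiplicativeM mS) // BE BE' Ax Ay mulrDr -!mulrA.
  by rewrite (mulrCA b b').
Qed.

Lemma rational_graphM S X Y x y : MSum S ->
  rational_graph S X x -> rational_graph S Y y ->
  rational_graph S (X * Y) (x * y).
Proof.
move=> mS [A [B [b [[SA SB] rb AE BE Ax]]]]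
  [A' [B' [b' [[SA' SB'] rb' AE' BE' Ay]]]].
exists (A * A'), (B * B'), (b * b'); split.
- by split; exact: MSum_domM.
- exact: RegM.
- by rewrite AE AE' mulrACA.
- by rewrite (multiplicativeM mS) // BE BE'.
- by rewrite (multiplicativeM mS) // Ax Ay mulrACA.
Qed.

Lemma rational_mult_MSum S : MSum S -> MSum (rational_mult S).
Proof.
move=> mS; have gf := rational_graph_functional mS.
apply: MSum_extension (multiplicative_summation mS) (extends_rational_mult mS) _ _ => X Y.
  move=> /of_graph_in gX /of_graph_in gY; have gXY := rational_graphD mS gX gY.
  split; last exact: of_graph_val.
  by exists (rational_mult S X + rational_mult S Y).
move=> /of_graph_in gX /of_graph_in gY; have gXY := rational_graphM mS gX gY.
split; last exact: of_graph_val.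
by exists (rational_mult S X * rational_mult S Y).
Qed.

(* If [A = B X] with [C A = A1] and [C' B = B1], where [C], [C'], [A1], [B1]
   lie in the original domain, then [(C B1) X = C' A1]. *)
Lemma rational_graph_rational_mult S X x : MSum S ->
  rational_graph (rational_mult S) X x -> rational_graph S X x.
Proof.
move=> mS [A [B [b [[QA QB] rb AE BE Ax]]]].
have [A1 [C [c [[SA1 SC] rc A1E CE A1x]]]] := of_graph_in QA.
have [B1 [C' [c' [[SB1 SC'] rc' B1E CE' B1x]]]] := of_graph_in QB.
have {}A1x : S A1 = c * (b * x) by rewrite A1x; congr (_ * _).
have {}B1x : S B1 = c' * b by rewrite B1x; congr (_ * _).
exists (C' * A1), (C * B1), (c * (c' * b)); split.
- by split; exact: MSum_domM.
- exact/RegM/RegM.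
- by rewrite A1E B1E AE -!mulrA (mulrCA C').
- by rewrite (multiplicativeM mS) // CE B1x.
- by rewrite (multiplicativeM mS) // CE' A1x -!mulrA (mulrCA c').
Qed.

Lemma rational_mult_idem S : MSum S ->
  rational_mult (rational_mult S) = rational_mult S.
Proof.
move=> mS; apply: extends_anti.
  apply: of_graph_extends (rational_graph_functional mS) => X x.
  exact: rational_graph_rational_mult.
exact/extends_rational_mult/rational_mult_MSum.
Qed.

(** * The rational extension of a weakly multiplicative summation *)

Lemma rational_MSumE S : MSum S -> rational S = rational_mult S.
Proof. by move=> mS; rewrite /rational multiplicative_ext_id. Qed.

Lemma rational_MSum S : wMSum S -> MSum (rational S).
Proof. by move=> /multiplicative_ext_MSum; exact: rational_mult_MSum. Qed.

Lemma extends_multiplicative_rational S : wMSum S ->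
  extends (multiplicative_ext S) (rational S).
Proof. by move=> /multiplicative_ext_MSum; exact: extends_rational_mult. Qed.

Lemma extends_rational S : wMSum S -> extends S (rational S).
Proof.
move=> wS; apply: extends_trans (extends_multiplicative_rational wS).
by have [_ [T [mT ST]]] := wS; exact: extends_multiplicative_ext mT ST.
Qed.

Lemma rational_idem S : wMSum S -> rational (rational S) = rational S.
Proof.
move=> wS; rewrite (rational_MSumE (rational_MSum wS)).
exact/rational_mult_idem/multiplicative_ext_MSum.
Qed.

(* [T] need not satisfy the summation axioms: embedding in a multiplicative
   summation suffices for its extensions to be well defined. *)
Lemma rational_mono S T U : MSum U -> extends S T -> extends T U ->
  extends (rational S) (rational T).
Proof.
move=> mU ST TU; apply: of_graph_extends (rational_graph_mono _) _.
  exact: multiplicative_ext_mono mU ST TU.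
apply: functional_graphS (rational_graph_functional mU).
apply: rational_graph_mono; rewrite -[U in extends _ U]multiplicative_ext_id //.
exact: multiplicative_ext_mono mU TU (extends_refl U).
Qed.

Lemma rational_sandwich S T : wMSum S -> extends S T ->
  extends T (rational S) -> rational T = rational S.
Proof.
move=> wS ST TQ; have mQ := rational_MSum wS; apply: extends_anti.
  rewrite -[X in extends _ X]rational_idem //.
  exact: rational_mono mQ TQ (extends_refl _).
exact: rational_mono mQ ST TQ.
Qed.

(** * The telescopic extension and its comparison with the rational one *)

(** The graph records the value of [S] at the polynomial [F] but not that [F] is in the domain; the
    latter, needed to transfer the value to [T], comes from the summation axioms. *)
Lemma telescopic_graph_mono S T : is_summation S -> extends S T ->
  forall X x, telescopic_graph S X x -> telescopic_graph T X x.
Proof.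
move=> sS [ST eST] X x [A [F [f [SA rf AE FE Ax]]]].
exists A, F, f; split; rewrite ?eST //; [exact: ST|exact: summation_poly].
Qed.

Lemma telescopic_graph_rational S : is_summation S ->
  forall X x, telescopic_graph S X x -> rational_graph S X x.
Proof.
move=> sS X x [A [F [f [SA rf AE FE Ax]]]].
by exists A, (fps_of_poly F), f; split=> //; split=> //; exact: summation_poly.
Qed.

Lemma telescopic_graph_functional S : MSum S ->
  functional_graph (telescopic_graph S).
Proof.
move=> mS; apply: functional_graphS (rational_graph_functional mS).
exact/telescopic_graph_rational/multiplicative_summation.
Qed.

Lemma telescopic_mono S T : is_summation S -> MSum T -> extends S T ->
  extends (telescopic S) (telescopic T).
Proof.
move=> sS mT ST; apply: of_graph_extends (telescopic_graph_mono sS ST) _.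
exact: telescopic_graph_functional.
Qed.

Lemma extends_telescopic S : wMSum S -> extends S (telescopic S).
Proof.
move=> [sS [T [mT ST]]]; apply: extends_of_graph => [|X SX].
  (* [S] itself need not be multiplicative, so uniqueness of values is inherited from [T]. *)
  apply: functional_graphS (telescopic_graph_functional mT).
  exact: telescopic_graph_mono.
have p1 : fps_of_poly 1 = 1 :> fps R by apply: fpsP => n /=; rewrite coef1.
exists X, 1, 1; split; rewrite ?p1 ?mul1r //; first exact: Reg1.
exact: summation1.
Qed.

Lemma telescopic_rational S : wMSum S -> telescopic (rational S) = rational S.
Proof.
move=> wS; have mQ := rational_MSum wS; apply: extends_anti; last first.
  exact/extends_telescopic/MSum_wMSum.
rewrite -[X in extends _ X]rational_idem // (rational_MSumE mQ).
apply: of_graph_extends (rational_graph_functional mQ).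
exact/telescopic_graph_rational/multiplicative_summation.
Qed.

(** Monotonicity is applied to the inclusion of [T] in [rational S], which the telescopic extension
    fixes. *)
Lemma extends_telescopic_rational S T : wMSum S -> is_summation T ->
  extends T (rational S) -> extends (telescopic T) (rational S).
Proof.
move=> wS sT TQ; rewrite -(telescopic_rational wS).
exact: telescopic_mono sT (rational_MSum wS) TQ.
Qed.

Lemma extends_multiplicative_ext_rational S T : wMSum S ->
  extends T (rational S) -> extends (multiplicative_ext T) (rational S).
Proof.
move=> wS TQ; have mQ := rational_MSum wS.
rewrite -[X in extends _ X]multiplicative_ext_id //.
exact: multiplicative_ext_mono mQ TQ (extends_refl _).
Qed.

End RationalExtension.

Theorem theorem5p3 (R : comNzRingType) (E : comAlgType R) :
  (* well-definedness: uniqueness of the values, and agreement of the two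
     definitions on multiplicative summations *)
  (forall S : presummation E, wMSum S ->
     functional_graph (rational_graph (multiplicative_ext S))) /\
  (forall S : presummation E, MSum S -> rational S = rational_mult S) /\
  is_functor (@wMSum R E) (@MSum R E) (@rational R E) /\
  is_extension_map (@rational R E) /\
  is_idempotent (@rational R E) /\
  subsumes (@rational R E) (@multiplicative_ext R E) /\
  subsumes (@rational R E) (@telescopic R E) /\
  subsumes (@rational R E) (fun S => multiplicative_ext (telescopic S)) /\
  subsumes (@rational R E) (fun S => telescopic (multiplicative_ext S)).

Proof.
split=> [S wS|]; first exact/rational_graph_functional/multiplicative_ext_MSum.
split; first exact: rational_MSumE.
split.
  split; first exact: rational_MSum.
  (* A multiplicative extension [U] of the larger summation bounds both. *)
  by move=> S T wS [_ [U [mU TU]]] ST; exact: rational_mono mU ST TU.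
split; first exact: extends_rational.
split; first exact: rational_idem.
have MS (S : presummation E) (wS : wMSum S) : extends S (multiplicative_ext S).
  by have [_ [T [mT ST]]] := wS; exact: extends_multiplicative_ext mT ST.
have QM (S : presummation E) (wS : wMSum S) := multiplicative_ext_id (rational_MSum wS).
split=> [S wS|].
  rewrite QM //; split=> //; apply/esym/rational_sandwich => //.
    exact: MS.
  exact: extends_multiplicative_rational.
have TQ (S : presummation E) (wS : wMSum S) : extends (telescopic S) (rational S).
  have [sS _] := wS; exact: extends_telescopic_rational (extends_rational wS).
split=> [S wS|].
  rewrite telescopic_rational //; split=> //; apply/esym/rational_sandwich => //.
    exact: extends_telescopic.
  exact: TQ.
split=> S wS.
  rewrite telescopic_rational // QM //; split=> //.
  apply/esym/rational_sandwich => //.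
    apply: extends_trans (extends_telescopic wS) _.
    (* [rational S] serves as the multiplicative extension of [telescopic S]. *)
    exact: extends_multiplicative_ext (rational_MSum wS) (TQ _ wS).
  exact/extends_multiplicative_ext_rational/TQ.
have mM := multiplicative_ext_MSum wS.
rewrite QM // telescopic_rational //; split=> //.
apply/esym/rational_sandwich => //.
  apply: extends_trans (MS _ wS) _.
  exact/extends_telescopic/MSum_wMSum.
(* The telescopic bound needs the summation axioms for [multiplicative_ext S], which [mM]
   provides. *)
apply: extends_telescopic_rational => //; first exact: multiplicative_summation.
exact: extends_multiplicative_rational.
Qed.
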